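(* Let $\epsilon$ be a real number with $0<\epsilon\le 8/5$. If $G$ is a graph with $\mathrm{mad}(G)\le 4-\epsilon$, then $\chi_o(G)\le \lfloor 8/\epsilon\rfloor+2$. Moreover, as $\epsilon\to 0$, infinitely often there exists a graph $G_\epsilon$ attaining $\lfloor 8/\epsilon\rfloor -1$; that is, there is a sequence of pairwise distinct real numbers $\epsilon\in(0,8/5]$ converging to $0$ such that for each $\epsilon$ in the sequence there exists a graph $G_{\epsilon}$ with $\mathrm{mad}(G_{\epsilon})=4-\epsilon$ and $\chi_o(G_{\epsilon})=\lfloor 8/\epsilon\rfloor-1$.
   Context: All graphs are finite, simple and have at least one vertex. A proper coloring of a graph $G$ is called odd if every non-isolated vertex $v$ has some color that appears an odd number of times on its (open) neighborhood $N(v)$. The smallest number of colors in an odd coloring of $G$ is denoted $\chi_o(G)$. The maximum average degree of $G$ is $\mathrm{mad}(G):=\max_{H\subseteq G}2|E(H)|/|V(H)|$, the maximum being over all non-empty subgraphs $H$ of $G$. *)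

(* Defs.v *)
From HB Require Import structures.
From mathcomp Require Import all_boot all_order all_algebra.
From mathcomp Require Import all_classical all_reals all_analysis.
Import Order.TTheory GRing.Theory Num.Theory.

Set Implicit Arguments.
Unset Strict Implicit.
Unset Printing Implicit Defensive.

Record sgraph := SGraph {
  vertex :> finType;
  adj : rel vertex;
  adj_sym : symmetric adj;
  adj_irr : irreflexive adj;
  vertex_gt0 : 0 < #|vertex|
}.

Definition edges (G : sgraph) : {set {set G}} :=
  [set [set p.1; p.2] | p : G * G & adj p.1 p.2].

(* A pair H = (V(H), E(H)); not necessarily induced. *)
Definition is_subgraph (G : sgraph) (H : {set G} * {set {set G}}) : bool :=
  (H.2 \subset edges G) && [forall e in H.2, e \subset H.1].

(* The default value 0 does not affect the maximum: the range is non-empty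
   (G has a vertex) and every ratio is nonnegative. *)
Definition mad (R : realFieldType) (G : sgraph) : R :=
  (\big[Num.max/0]_(H : {set G} * {set {set G}}
                    | (H.1 != finset.set0) && is_subgraph H)
     (2 * #|H.2|%:R / #|H.1|%:R))%R.

Definition proper_coloring (G : sgraph) (k : nat) (f : {ffun G -> 'I_k}) : bool :=
  [forall x, forall y, adj x y ==> (f x != f y)].

Definition isolated (G : sgraph) (v : G) : bool := [forall u, ~~ adj v u].

Definition odd_coloring (G : sgraph) (k : nat) (f : {ffun G -> 'I_k}) : bool :=
  proper_coloring f &&
  [forall v, ~~ isolated v ==>
     [exists c : 'I_k, odd #|[set u | adj v u & f u == c]%SET|]].

Definition odd_colorable (G : sgraph) (k : nat) : bool :=
  [exists f : {ffun G -> 'I_k}, odd_coloring f].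

Lemma odd_colorable_ex (G : sgraph) : exists k, odd_colorable G k.
Proof.
exists #|G|; apply/existsP; exists [ffun x => enum_rank x]; apply/andP; split.
  apply/'forall_forallP => x y; apply/implyP => xy.
  by rewrite !ffunE (inj_eq enum_rank_inj); apply: contraTneq xy => ->; rewrite adj_irr.
apply/forallP => v; apply/implyP => /forallPn[u /negPn vu].
apply/existsP; exists (enum_rank u).
suff -> : [set w | adj v w & [ffun x => enum_rank x] w == enum_rank u]%SET
          = [set u]%SET by rewrite cards1.
apply/setP => w; rewrite !inE ffunE (inj_eq enum_rank_inj).
by case: eqVneq => [->|_]; rewrite ?vu ?andbF.
Qed.

Definition chi_o (G : sgraph) : nat := ex_minn (odd_colorable_ex G).

(* Main.v *)
Require Import Defs.
From HB Require Import structures.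
From mathcomp Require Import all_boot all_order all_algebra.
From mathcomp Require Import all_classical all_reals all_analysis.
From mathcomp Require Import zify ring lra.
Import Order.TTheory GRing.Theory Num.Theory.
Import numFieldNormedType.Exports.

Set Implicit Arguments.
Unset Strict Implicit.
Unset Printing Implicit Defensive.

(** Upper bound.  Let k be the integer part of 8 / eps, plus 2.  One shows by
    induction on A that every induced subgraph G[A] has an odd coloring with k
    colors.  A vertex v of G[A], of degree d and with d2 neighbors of degree 2,
    can be removed together with these d2 neighbors when 2 d < k + d2, provided
    that d is odd, or d2 > 0, or d = 0 ([reducible_extends]).  Indeed, given an
    odd coloring of the rest, v has to avoid two colors for each of its d - d2
    other neighbors (the color of that neighbor, and a color whose odd parity
    satisfies the neighbor), and one color for each neighbor u of degree 2
    (the color of the second neighbor of u, so that u will see two different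
    colors).  The vertices u are then colored one at a time, each avoiding at
    most four colors.  The vertex v itself is taken care of by parity: a vertex
    with an odd number of colored neighbors always sees a color an odd number
    of times.  If d is even, this holds just before the last u is colored, and
    the last u can preserve it.

    A reducible vertex exists by discharging ([exists_reducible]): otherwise
    give v the charge d - (4 - eps), of nonpositive total, and let each vertex
    of degree 2 receive 1 - eps / 2 from each neighbor.  The degrees 0, 1 and 3
    do not occur and two vertices of degree 2 are never adjacent, so that
    vertices of degree 2 end with charge 0.  All others end with a positive
    charge, because (k - 1) eps > 8.  Since some vertex has degree other than
    2, the total is positive, a contradiction.

    Lower bound.  Subdivide each edge of K_n once.  A subdividing vertex has
    degree 2, so its two neighbors get different colors; hence the n original
    vertices have pairwise different colors.  If n is even, the original
    vertices have odd degree and any proper extension is odd, so n colors are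
    enough ([chi_o_subdivision]).  A double count of the edges of a subgraph
    gives mad = 4 (n - 1) / (n + 1) = 4 - eps with eps = 8 / (n + 1)
    ([mad_subdivision]), and then n = 8 / eps - 1. *)

(** * Odd colorings of induced subgraphs and their extensions *)

Section PartialColorings.
Import boot.fintype boot.finset.

Variable G : sgraph.
Implicit Types (A B U W : {set G}) (u v w x y : G).

(** Induced subgraphs of [G] are represented by their vertex sets, and colorings
    are total functions whose values outside the set are ignored; removing or
    adding a vertex then never changes a type. *)
Definition nbr A v : {set G} := [set u in A | adj v u].
Definition deg A v := #|nbr A v|.
Definition nbr2 A v : {set G} := [set u in nbr A v | deg A u == 2].

Section Colors.
Variable k : nat.
Implicit Types (f g : G -> 'I_k) (c : 'I_k).

Definition occ A f v c := #|[set u in nbr A v | f u == c]|.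
Definition proper_on A f := {in A &, forall x y, adj x y -> f x != f y}.
Definition satisfied A f v := (nbr A v == set0) || [exists c, odd (occ A f v c)].
(** The default [f v] adds no constraint: a new neighbor of [v] has to avoid the
    color of [v] anyway. *)
Definition witness A f v := odflt (f v) [pick c | odd (occ A f v c)].

Definition recolor f x c : G -> 'I_k := fun z => if z == x then c else f z.

Lemma witnessP A f v : satisfied A f v ->
  nbr A v = set0 \/ odd (occ A f v (witness A f v)).
Proof.
case/orP => [/eqP|/existsP[c oc]]; [by left | right].
by rewrite /witness; case: pickP => [//|/(_ c)]; rewrite oc.
Qed.

Lemma deg_occ A f v : deg A v = \sum_c occ A f v c.
Proof.
rewrite /deg -sum1_card (partition_big f predT) //=.
apply: eq_bigr => c _; rewrite /occ -sum1_card.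
by apply: eq_bigl => u; rewrite !inE.
Qed.

(** The numbers of occurrences of the colors add up to the degree, so they
    cannot all be even. *)
Lemma odd_deg_satisfied A f v : odd (deg A v) -> satisfied A f v.
Proof.
rewrite (deg_occ A f) => od; apply/orP; right.
apply: contraLR od => /existsPn ev.
elim/big_ind: _ => [//|m n|c _]; last exact: ev.
by rewrite oddD => /negPf-> /negPf->.
Qed.

Lemma unique_color_satisfied A f v w :
  w \in nbr A v -> {in nbr A v, forall u, u != w -> f u != f w} ->
  satisfied A f v.
Proof.
move=> wN uniq_w; apply/orP; right; apply/existsP; exists (f w).
suff -> : occ A f v (f w) = 1 by [].
rewrite /occ; apply/eqP/cards1P; exists w; apply/setP => u.
rewrite inE in_set1; case: (eqVneq u w) => [->|uw]; first by rewrite wN eqxx.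
by apply/negP => /andP[uN]; apply/negP/uniq_w.
Qed.

Lemma nbr_notin A x y : x \notin A -> ~~ adj x y -> nbr (x |: A) y = nbr A y.
Proof.
move=> xA xy; apply/setP => z; rewrite !inE.
by case: eqVneq => [->|//]; rewrite adj_sym (negPf xy) !andbF.
Qed.

Lemma nbrU1 A x y : adj x y -> nbr (x |: A) y = x |: nbr A y.
Proof.
move=> xy; apply/setP => z; rewrite !inE.
by case: eqVneq => [->|//]; rewrite adj_sym xy.
Qed.

Lemma occ_recolor A f x c y e : x \notin A ->
  occ A (recolor f x c) y e = occ A f y e.
Proof.
move=> xA; apply: eq_card => z; rewrite !inE /recolor.
by case: (eqVneq z x) => [->|//]; rewrite (negPf xA).
Qed.

Lemma proper_on_recolor A f x c : x \notin A -> proper_on A f ->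
  c \notin f @: nbr A x -> proper_on (x |: A) (recolor f x c).
Proof.
move=> xA fA cN y z; rewrite !inE /recolor.
have cP t : t \in A -> adj x t -> c != f t.
  move=> tA xt; apply: contraNneq cN => ->; apply: imset_f.
  by rewrite inE tA.
case: (eqVneq y x) => [->|yx] /=; case: (eqVneq z x) => [->|zx] //=.
- by rewrite adj_irr.
- by move=> _ zA; apply: cP.
- by move=> yA _; rewrite adj_sym eq_sym; apply: cP.
by move=> yA zA; apply: fA.
Qed.

(** A new neighbor that avoids the witness of [y] leaves the parity of that color
    unchanged.  If [y] had no neighbor before, it now has exactly one. *)
Lemma satisfied_recolor A f x c y : x \notin A -> y != x ->
  (adj x y -> c != witness A f y) ->
  satisfied A f y -> satisfied (x |: A) (recolor f x c) y.
Proof.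
move=> xA yx cy sy; case: (boolP (adj x y)) => xy; last first.
  rewrite /satisfied nbr_notin //; case/orP: sy => [->//|/existsP[e oe]].
  apply/orP; right; apply/existsP; exists e.
  suff -> : occ (x |: A) (recolor f x c) y e = occ A f y e by [].
  by rewrite -(occ_recolor _ c _ _ xA) /occ nbr_notin.
case: (witnessP sy) => [N0|ow].
  apply: odd_deg_satisfied; rewrite /deg nbrU1 // N0 setU0.
  by rewrite cards1.
apply/orP; right; apply/existsP; exists (witness A f y).
suff -> : occ (x |: A) (recolor f x c) y (witness A f y)
          = occ A f y (witness A f y) by [].
rewrite -[RHS](occ_recolor _ c _ _ xA) /occ nbrU1 //.
apply: eq_card => z; rewrite !inE.
case: (eqVneq z x) => [->|//]; rewrite /recolor eqxx (negPf xA) /=.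
by rewrite (negPf (cy xy)).
Qed.

(** In the applications [f] is the coloring and [g] the witness function: a
    neighbor in [N] forbids two colors, a vertex of [W] only one. *)
Lemma color_avoiding f g (N W : {set G}) : 2 * #|N| + #|W| < k ->
  exists c, [/\ c \notin f @: N, c \notin g @: N & c \notin f @: W].
Proof.
move=> lt_k; pose F := f @: N :|: g @: N :|: f @: W.
suff /existsP[c] : [exists c, c \notin F].
  by rewrite !in_setU !negb_or -andbA => /and3P[]; exists c.
rewrite -negb_forall; apply: contraL lt_k => /forallP FT; rewrite -leqNgt.
rewrite -[leqLHS]card_ord; apply: (@leq_trans #|F|).
  by apply/subset_leq_card/subsetP => c _; apply: FT.
apply: leq_trans (leq_card_setU _ _).1 _.
apply: leq_add (leq_imset_card _ _); apply: leq_trans (leq_card_setU _ _).1 _.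
by rewrite mul2n -addnn leq_add ?leq_imset_card.
Qed.

Definition odd_on A f := proper_on A f /\ {in A, forall y, satisfied A f y}.

(** Parity gives the central vertex [v] an odd color directly when its degree is
    odd; when the degree is even and positive, a neighbor of degree 2 must be
    available to be colored last.  The inequality leaves a color for [v] itself,
    see [color_center]. *)
Definition reducible A v :=
  (deg A v == 0) ||
  (odd (deg A v) || (nbr2 A v != set0)) && (2 * deg A v < k + #|nbr2 A v|).

(** A neighbor [u] of degree 2 is uncolored at this stage, so it forbids only the
    color of its second neighbor, and this is what gives the last clause; each
    other neighbor of [v] forbids its color and its witness. *)
Lemma color_center A v : v \in A -> 0 < k -> 
  2 * deg A v < k + #|nbr2 A v| ->
  let A0 := A :\: (v |: nbr2 A v) in
  forall f, odd_on A0 f ->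
  exists g, [/\ proper_on (v |: A0) g,
    {in A0, forall y, satisfied (v |: A0) g y}
    & forall u w, u \in nbr2 A v -> w \in A0 -> adj u w -> g w != g v].
Proof.
move=> vA k_gt0 dk A0 f [fP fS].
have vA0 : v \notin A0 by rewrite !inE eqxx.
pose N := nbr A v :\: nbr2 A v.
(* [T] collects the second neighbors of the vertices of degree 2. *)
pose T := \bigcup_(u in nbr2 A v) nbr A0 u.
have T_le : #|T| <= #|nbr2 A v|.
  rewrite -[leqRHS]sum1_card; apply: (leq_trans (unstable.card_big_setU _ _ _)).
  apply: leq_sum => u; rewrite !inE => /andP[/andP[uA vu] /eqP du].
  rewrite -ltnS -du /deg; apply: proper_card; apply/properP; split.
    by apply/subsetP => z; rewrite !inE => /andP[/andP[_ ->]].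
  by exists v; rewrite !inE ?vA ?eqxx //= adj_sym.
have N_eq : #|N| = deg A v - #|nbr2 A v|.
  rewrite cardsD; congr (_ - _); apply: eq_card => z; rewrite !inE.
  by case: (z \in A) => //=; case: adj.
have sub2 : #|nbr2 A v| <= deg A v.
  by apply/subset_leq_card/subsetP => z; rewrite inE => /andP[].
have [|c [cN cW cT]] := color_avoiding f (witness A0 f) (N := N) (W := T).
  move: T_le N_eq sub2 dk; lia.
have N_sub y : y \in A0 -> adj v y -> y \in N.
  by rewrite !inE negb_or => /andP[/andP[_ ->] ->] ->.
exists (recolor f v c); split.
- apply: proper_on_recolor => //; apply: contra cN.
  by apply/subsetP/imsetS/subsetP => y; rewrite inE => /andP[]; apply: N_sub.
- move=> y yA0; apply: satisfied_recolor => //; last exact: fS.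
    by apply: contraTneq yA0 => ->.
  move=> vy; apply: contraNneq cW => ->; apply: imset_f; exact: N_sub.
move=> u w uU wA0 uw; rewrite /recolor eqxx ifN; last by apply: contraTneq wA0 => ->.
rewrite eq_sym; apply: contraNneq cT => ->; apply: imset_f.
by apply/bigcupP; exists u => //; rewrite inE wA0.
Qed.

(** The at most two neighbors of [u] forbid at most four colors.  As [v] has a
    color that no other neighbor of [u] has, [u] sees that color once.  The last
    clause preserves the satisfaction of each vertex separately, because the
    central vertex [v] may be unsatisfied at this point. *)
Lemma add_vertex_deg_le2 B u v g : 4 < k -> u \notin B -> v \in B -> adj v u ->
  deg B u <= 2 -> proper_on B g ->
  {in nbr B u, forall w, w != v -> g w != g v} ->
  exists c, let g' := recolor g u c in
  [/\ proper_on (u |: B) g', satisfied (u |: B) g' u &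
    {in B, forall y, satisfied B g y -> satisfied (u |: B) g' y}].
Proof.
move=> k4 uB vB vu du gP gv.
have [|c [cN cW _]] := color_avoiding g (witness B g) (N := nbr B u) (W := set0).
  by rewrite cards0 addn0; apply: leq_ltn_trans k4; rewrite (leq_mul2l 2 _ 2).
exists c; split.
- exact: proper_on_recolor.
- have Nu : nbr (u |: B) u = nbr B u.
    by apply/setP => z; rewrite !inE; case: eqVneq => [->|//]; rewrite adj_irr !andbF.
  apply: (unique_color_satisfied (w := v)); rewrite Nu.
    by rewrite inE vB adj_sym.
  move=> w wN wv; rewrite /recolor !ifN ?gv //.
    by apply: contraNneq uB => <-.
  by apply: contraNneq uB => <-; move: wN; rewrite inE => /andP[].
move=> y yB; apply: satisfied_recolor => //; first by apply: contraNneq uB => <-.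
by move=> uy; apply: contraNneq cW => ->; apply: imset_f; rewrite inE yB.
Qed.

(** After [v], the vertices of [nbr2 A v] are added one by one.  The invariant
    leaves out the satisfaction of [v], which is established at the end by
    parity. *)
Lemma reducible_extends A v : 4 < k -> v \in A -> reducible A v ->
  (forall f, odd_on (A :\: (v |: nbr2 A v)) f -> exists g, odd_on A g) .
Proof.
move=> k4 vA red f fA0; set A0 := A :\: _ in fA0.
have k_gt0 : 0 < k by apply: leq_trans k4.
have dk : 2 * deg A v < k + #|nbr2 A v|.
  by case/orP: red => [/eqP->|/andP[]//]; rewrite muln0 addn_gt0 k_gt0.
have [g0 [g0P g0S g0v]] := color_center vA k_gt0 dk fA0.
pose ok W g := [/\ proper_on (W :|: (v |: A0)) g,
    {in W :|: A0, forall y, satisfied (W :|: (v |: A0)) g y}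
    & forall u w, u \in nbr2 A v -> w \in A0 -> adj u w -> g w != g v].
have v2 : v \notin nbr2 A v by rewrite !inE adj_irr andbF.
have vA0 : v \notin A0 by rewrite !inE eqxx.
have A0A : A0 \subset A by apply: subsetDl.
have UA : nbr2 A v \subset A by apply/subsetP => z; rewrite !inE => /andP[/andP[]].
have step W u g : W \subset nbr2 A v -> u \in nbr2 A v -> u \notin W -> ok W g ->
    exists g', ok (u |: W) g' /\
     (satisfied (W :|: (v |: A0)) g v -> satisfied (u |: W :|: (v |: A0)) g' v).
  move=> WU uU uW [gP gS gv].
  have uv : u != v by apply: contraTneq uU => ->.
  have uA0 : u \notin A0 by rewrite 3!inE uU orbT.
  have [||||||c [g'P g'u g'S]] := @add_vertex_deg_le2 (W :|: (v |: A0)) u v g k4.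
  - by rewrite in_setU in_setU1 !negb_or uW uv.
  - by rewrite !inE eqxx orbT.
  - by move: uU; rewrite !inE => /andP[/andP[]].
  - move: (uU); rewrite !inE => /andP[_ /eqP<-].
    apply/subset_leq_card/subsetP => z.
    rewrite in_set [z \in nbr A u]in_set => /andP[zB ->]; rewrite andbT.
    move: zB; rewrite in_setU in_setU1.
    by case/or3P=> [/(subsetP WU)/(subsetP UA)|/eqP->|/(subsetP A0A)].
  - exact: gP.
  (* The second neighbor of [u] differs in color from [v] by the choice of the
     color of [v], or, if it lies in [W], because it is adjacent to [v]. *)
  - move=> w; rewrite inE => /andP[wB uw] wv.
    have: w \in W :|: (v |: A0) by [].
    rewrite in_setU in_setU1 (negPf wv) /= => /orP[wW|wA0]; last exact: gv uU wA0 uw.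
    apply: gP => //; first by rewrite !inE eqxx orbT.
    by have := subsetP WU _ wW; rewrite adj_sym !inE => /andP[/andP[]].
  exists (recolor g u c); rewrite /ok -[_ :|: (v |: A0)]setUA; split; last first.
    by apply: g'S; rewrite !inE eqxx orbT.
  split=> // [y|u' w u'U wA0 u'w].
    rewrite -setUA in_setU1; have [->//|_ /= yB] := eqVneq y u.
    apply: g'S; last exact: gS.
    by move: yB; rewrite !in_setU => /orP[->//|->]; rewrite !orbT.
  rewrite /recolor [v == u]eq_sym (negPf uv) ifN; last by apply: contraNneq uA0 => <-.
  exact: gv u'w.
have all_ok W : W \subset nbr2 A v -> exists g, ok W g.
  have [n] := ubnP #|W|; elim: n W => // n IH W Wn WU.
  have [->|[u uW]] := set_0Vmem W; first by exists g0; rewrite /ok !set0U.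
  have W'U : W :\ u \subset nbr2 A v by apply: subset_trans (subsetDl _ _) WU.
  have [|g gW] := IH (W :\ u) _ W'U; first by rewrite (cardsD1 u) uW in Wn.
  have [||g' [g'W _]] := step _ u g W'U _ _ gW; last by exists g'; rewrite -(setD1K uW).
    exact: subsetP uW.
  by rewrite !inE eqxx.
have UV : nbr2 A v :|: (v |: A0) = A.
  apply/setP => z; rewrite in_setU in_setU1 in_setD in_setU1.
  case: (boolP (z \in nbr2 A v)) => [/(subsetP UA)->//|_].
  by case: eqVneq => [->|].
have finish g : ok (nbr2 A v) g -> satisfied A g v -> odd_on A g.
  rewrite /ok UV => -[gP gS _] gv; split=> // y yA.
  have [->//|yv] := eqVneq y v.
  by apply: gS; move: (yA); rewrite -{1}UV !in_setU in_set1 (negPf yv).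
have [g gU] := all_ok _ (subxx _).
case/orP: red => [|/andP[]].
  rewrite cards_eq0 => N0; exists g; apply: finish => //.
  by apply/orP; left.
have [od _ _|ev /= /set0Pn[u uU] _] := boolP (odd (deg A v)).
  by exists g; apply: finish => //; apply: odd_deg_satisfied.
(* The degree is even: color [u] last.  Before that, [v] has an odd number of
   colored neighbors. *)
have [h hW] := all_ok (nbr2 A v :\ u) (subsetDl _ _).
have [|h' []] := step _ u h (subsetDl _ _) uU _ hW.
  by rewrite !inE eqxx.
rewrite setD1K // UV => h'U h'v; exists h'; apply: finish => //; apply: h'v.
apply: odd_deg_satisfied; move: ev.
have uv : adj u v by move: uU; rewrite !inE adj_sym => /andP[/andP[]].
have -> : deg A v = (deg (nbr2 A v :\ u :|: (v |: A0)) v).+1.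
  transitivity (deg (u |: (nbr2 A v :\ u :|: (v |: A0))) v).
    by rewrite setUA setD1K // UV.
  rewrite /deg nbrU1 // cardsU1 (_ : u \notin _) //.
  rewrite [u \in _]in_set negb_and; apply/orP; left.
  rewrite in_setU in_setU1 in_setD1 eqxx /= in_setD in_setU uU orbT orbF.
  by apply: contraTneq uU => ->.
by rewrite /= negbK.
Qed.

Lemma odd_on_by_reduction : 4 < k ->
  (forall A, A != set0 -> exists2 v, v \in A & reducible A v) ->
  forall A, exists f, odd_on A f.
Proof.
move=> k4 red A; have [n] := ubnP #|A|; elim: n A => // n IH A An.
have [->|/red[v vA vred]] := eqVneq A set0.
  exists (fun=> Ordinal (leq_trans (isT : 0 < 5) k4)).
  by split=> [x y|x]; rewrite inE.
have [|f fP] := IH (A :\: (v |: nbr2 A v)).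
  rewrite -ltnS; apply: leq_trans An; rewrite ltnS; apply: proper_card; apply/properP; split.
    exact: subsetDl.
  by exists v; rewrite // !inE eqxx.
exact: reducible_extends fP.
Qed.

Lemma odd_on_setT f : odd_on [set: G] f -> odd_colorable G k.
Proof.
move=> [fP fS]; apply/existsP; exists [ffun x => f x]; apply/andP; split.
  apply/forallP => x; apply/forallP => y; apply/implyP => xy.
  by rewrite !ffunE; apply: fP; rewrite ?inE.
apply/forallP => v; apply/implyP => /forallPn[u /negPn vu].
case/orP: (fS v (in_setT v)) => [/eqP/setP/(_ u)|]; first by rewrite !inE vu.
case/existsP => c oc; apply/existsP; exists c; move: oc.
by congr (odd _); apply: eq_card => z; rewrite !inE ffunE.
Qed.
End Colors.
End PartialColorings.

(** * Maximum average degree and discharging *)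

Section MaximumAverageDegree.
Import boot.fintype boot.finset.

Variable G : sgraph.
Implicit Types (A S : {set G}) (u v x y : G) (H : {set G} * {set {set G}}).

Definition induced_edges A : {set {set G}} := [set e in edges G | e \subset A].

Lemma induced_subgraph A : is_subgraph (A, induced_edges A).
Proof.
apply/andP; split; first by apply/subsetP => e; rewrite inE => /andP[].
by apply/forall_inP => e; rewrite inE => /andP[].
Qed.

Lemma card_incident_edges A v : v \in A ->
  deg A v <= #|[set e in induced_edges A | v \in e]|.
Proof.
move=> vA; have inj_v : {in nbr A v &, injective (fun u => [set v; u])}.
  move=> x y; rewrite !inE => /andP[_ vx] _ /setP/(_ x).
  rewrite !inE eqxx orbT; case: eqVneq vx => [->|_ _ /esym/eqP//].
  by rewrite adj_irr.
rewrite /deg -(card_in_imset inj_v).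
apply/subset_leq_card/subsetP => e /imsetP[u].
rewrite inE => /andP[uA vu ->]; rewrite in_set set21 andbT in_set; apply/andP; split.
  by apply/imsetP; exists (v, u); rewrite ?inE.
by apply/subsetP => z; rewrite !inE => /orP[]/eqP->.
Qed.

(** Each edge is counted once for each of its ends in [S]: [m = 2] is half of the
    handshake lemma, and [m = 1] is the case of an independent set [S]. *)
Lemma sum_deg_le A S m : S \subset A ->
  (forall x y, adj x y -> #|[set x; y] :&: S| <= m) ->
  \sum_(v in S) deg A v <= m * #|induced_edges A|.
Proof.
move=> /subsetP SA Sm.
apply: (@leq_trans (\sum_(v in S) \sum_(e in induced_edges A) (v \in e))).
  apply: leq_sum => v /SA/card_incident_edges/leq_trans->//.
  rewrite -sum1_card big_mkcond [leqRHS]big_mkcond leq_sum // => e _.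
  by rewrite in_set; case: (e \in induced_edges A) => //; case: (v \in e).
rewrite exchange_big /= mulnC -sum_nat_const; apply: leq_sum => e.
rewrite inE => /andP[/imsetP[[x y]] /= + -> _]; rewrite inE => /Sm/(leq_trans _)->//.
rewrite -sum1_card [leqRHS]big_mkcond [leqLHS]big_mkcond leq_sum // => z _.
by rewrite in_setI; case: (z \in [set x; y]); case: (z \in S).
Qed.

Lemma card_edges_le_cover H S : is_subgraph H ->
  (forall x y, adj x y -> (x \in S) || (y \in S)) ->
  #|H.2| <= \sum_(v in H.1 :&: S) deg [set: G] v.
Proof.
move=> /andP[/subsetP Hedges /forall_inP Hends] cov.
pose star v := (fun u => [set v; u]) @: nbr [set: G] v.
apply: (@leq_trans #|\bigcup_(v in H.1 :&: S) star v|).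
  apply/subset_leq_card/subsetP => e eH; have eV := Hends _ eH.
  case/imsetP: (Hedges _ eH) => [[x y]]; rewrite inE /= => xy exy.
  move: eV; rewrite exy subUset !sub1set => /andP[xV yV].
  case/orP: (cov _ _ xy) => [xS|yS]; apply/bigcupP.
    by exists x; [rewrite inE xV | apply/imsetP; exists y; rewrite ?inE].
  exists y; [by rewrite inE yV | apply/imsetP; exists x].
    by rewrite !inE adj_sym.
  by rewrite setUC.
apply: leq_trans (unstable.card_big_setU _ _ _) _.
by apply: leq_sum => v _; apply: leq_imset_card.
Qed.

Variable R : realFieldType.
Local Open Scope ring_scope.

Lemma mad_ge H : H.1 != set0 -> is_subgraph H ->
  2 * #|H.2|%:R / #|H.1|%:R <= mad R G.
Proof.
move=> H0 sH; apply: (@le_bigmax_cond _ _ _ _ H _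
  (fun H => 2 * #|H.2|%:R / #|H.1|%:R)).
by rewrite H0.
Qed.

Lemma mad_induced A (a : R) : A != set0 -> mad R G <= a ->
  (\sum_(v in A) deg A v)%:R <= a * #|A|%:R.
Proof.
move=> A0 Ga.
have A_gt0 : 0 < #|A|%:R :> R by rewrite ltr0n card_gt0.
have := @mad_ge (A, induced_edges A) A0.
rewrite induced_subgraph /= => /(_ isT)/le_trans/(_ Ga).
rewrite ler_pdivrMr //; apply: le_trans.
rewrite -natrM ler_nat; apply: sum_deg_le => // x y _.
by apply: leq_trans (subset_leq_card (subsetIl _ _)) _; rewrite cards2; case: eqP.
Qed.

Lemma sum_nbr2 A :
  (\sum_(v in A) #|nbr2 A v| = \sum_(v in A) 2 * (deg A v == 2))%N.
Proof.
pose F v u : nat := adj v u && (deg A u == 2).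
transitivity (\sum_(v in A) \sum_(u in A) F v u)%N.
  apply: eq_bigr => v _; rewrite -sum1_card big_mkcond [RHS]big_mkcond.
  by apply: eq_bigr => u _; rewrite !inE /F; case: (u \in A); case: adj; case: eqP.
rewrite exchange_big; apply: eq_bigr => u uA; rewrite /F.
case: eqP => [du|_]; last by rewrite big1 // => v _; rewrite andbF.
rewrite muln1 -[RHS]du /deg -sum1_card big_mkcond [RHS]big_mkcond.
by apply: eq_bigr => v _; rewrite inE adj_sym; case: (v \in A); case: adj.
Qed.

(** The charge left to a vertex of degree [d >= 4] once it has paid [1 - eps / 2]
    to each of its [d2] neighbors of degree 2.  For [d >= k] it can afford
    [d2 = d], since [(d + 2) eps > 8].  For [d < k] the worst case is
    [d2 = 2 d - k]. *)
Lemma final_charge_gt0 (eps : R) (k d d2 : nat) :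
  0 < eps -> eps <= 8 / 5 -> (6 < k)%N -> 8 < (k%:R - 1) * eps ->
  (3 < d)%N -> (d2 <= d)%N -> (d2 = 0 \/ k + d2 <= 2 * d)%N ->
  0 < d%:R - (4 - eps) - d2%:R * (1 - eps / 2).
Proof.
move=> e0 e1 k6 ke d3 d2d.
have d3' : 4 <= d%:R :> R by rewrite ler_nat.
have k6' : 7 <= k%:R :> R by rewrite ler_nat.
case=> [->|kd].
  by rewrite mul0r; lra.
have e2 : 0 <= 1 - eps / 2 by lra.
have d2d' : d2%:R <= d%:R :> R by rewrite ler_nat.
have kd' : k%:R + d2%:R <= 2 * d%:R :> R by rewrite -natrD -natrM ler_nat.
have [k_le_d|d_lt_k] := leqP k d.
  have k_le_d' : k%:R <= d%:R :> R by rewrite ler_nat.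
  have : d2%:R * (1 - eps / 2) <= d%:R * (1 - eps / 2) by rewrite ler_wpM2r.
  have : k%:R * eps <= d%:R * eps by rewrite ler_wpM2r // ltW.
  by lra.
have d_lt_k' : d%:R + 1 <= k%:R :> R by rewrite natr1 ler_nat.
have : d2%:R * (1 - eps / 2) <= (2 * d%:R - k%:R) * (1 - eps / 2).
  by rewrite ler_wpM2r //; lra.
have : 0 <= d2%:R :> R by [].
(* The worst-case charge is [k - d - 4 + eps (1 + d - k / 2)].  It increases
   with [eps]; [K] is its value at [eps = 8 / (k - 1)], times [k - 1]. *)
have K : 0 < (k%:R - d%:R - 4) * (k%:R - 1) + 8 * (1 + d%:R - k%:R / 2) :> R.
  have -> : (k%:R - d%:R - 4) * (k%:R - 1) + 8 * (1 + d%:R - k%:R / 2)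
     = (k%:R - d%:R) * (k%:R - 9) + 12 :> R by field.
  have [k9|k9] := leqP 9 k.
    have : 9 <= k%:R :> R by rewrite ler_nat.
    by move=> ?; rewrite ltr_wpDl // mulr_ge0 //; lra.
  have {k9} : (k == 7) || (k == 8) by lia.
  by case/orP => /eqP ?; subst k; lra.
move=> d2_ge0 le_d2.
have Q : 0 <= ((k%:R - 1) * eps - 8) * (1 + d%:R - k%:R / 2) by rewrite mulr_ge0; lra.
suff : 0 < ((k%:R - d%:R - 4) + eps * (1 + d%:R - k%:R / 2)) * (k%:R - 1).
  by rewrite pmulr_lgt0; lra.
by lra.
Qed.

(** The discharging argument.  The sum of the final charges is that of the
    initial ones because a vertex of degree 2 is paid by exactly two vertices
    ([sum_nbr2]). *)
Lemma exists_reducible (eps : R) k A :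
  0 < eps -> eps <= 8 / 5 -> (6 < k)%N -> 8 < (k%:R - 1) * eps ->
  mad R G <= 4 - eps -> A != set0 -> exists2 v, v \in A & reducible k A v.
Proof.
move=> e0 e1 k6 ke Gmad A0.
apply/exists_inP; apply: contraT => /exists_inPn noR.
have irr v : v \in A -> (0 < deg A v)%N /\
    (odd (deg A v) || (nbr2 A v != set0) -> (k + #|nbr2 A v| <= 2 * deg A v)%N).
  move=> /noR; rewrite /reducible negb_or -lt0n => /andP[-> nR]; split=> // h.
  by move: nR; rewrite h /= -leqNgt.
have d2_le v : (#|nbr2 A v| <= deg A v)%N.
  by apply/subset_leq_card/subsetP => z; rewrite inE => /andP[].
pose charge v : R := (deg A v)%:R - (4 - eps) - #|nbr2 A v|%:R * (1 - eps / 2)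
   + (2 * (deg A v == 2))%:R * (1 - eps / 2).
have deg2 v : v \in A -> deg A v = 2 -> nbr2 A v = set0.
  move=> /irr[_ +] d2; rewrite d2 /=; case: eqP => // _ /(_ isT); lia.
have charge_pos v : v \in A -> deg A v != 2 -> 0 < charge v.
  move=> vA d2; have [d0 dk] := irr v vA.
  rewrite /charge (negPf d2) muln0 mul0r addr0; apply: (final_charge_gt0 e0 e1 k6 ke) => //.
    rewrite ltnNge; apply/negP => d3.
    have od : odd (deg A v) by move: d0 d2 d3; case: (deg A v) => [|[|[|[|]]]].
    by move: (dk (introT orP (or_introl od))); lia.
  have [N0|N0] := eqVneq (nbr2 A v) set0; first by left; rewrite N0 cards0.
  by right; apply: dk; rewrite N0 orbT.
have charge_ge0 v : v \in A -> 0 <= charge v.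
  move=> vA; have [d2|d2] := eqVneq (deg A v) 2; last exact/ltW/charge_pos.
  by rewrite /charge deg2 // cards0 d2 eqxx muln1; lra.
(* A neighbor of a vertex of degree 2 does not have degree 2. *)
have [v vA d2] : exists2 v, v \in A & deg A v != 2.
  case/set0Pn: A0 => v vA; have [d2|] := eqVneq (deg A v) 2; last by exists v.
  have : (0 < #|nbr A v|)%N by rewrite -/(deg A v) d2.
  case/card_gt0P => u uv; exists u; first by move: uv; rewrite inE => /andP[].
  have /setP/(_ u) := deg2 v vA d2.
  by rewrite in_set uv in_set0 => /negbT.
have : 0 < \sum_(v in A) charge v.
  rewrite (bigD1 v) //= ltr_pwDl ?charge_pos // sumr_ge0 // => u /andP[uA _].
  exact: charge_ge0.
rewrite /charge big_split big_split big_split /= !sumrN -!mulr_suml -!natr_sum.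
rewrite sum_nbr2 subrK sumr_const -[_ *+ #|A|]mulr_natr subr_gt0.
by rewrite ltNge mad_induced.
Qed.

End MaximumAverageDegree.

(** * Complete graphs with every edge subdivided *)

Section SubdividedComplete.
Import boot.fintype boot.finset.

Variable n : nat.
Hypothesis n_gt0 : 0 < n.

Definition two_set := {e : {set 'I_n} | #|e| == 2}.
Definition sub_vertex : finType := ('I_n + two_set)%type.

Definition sub_adj : rel sub_vertex := fun x y =>
  match x, y with
  | inl i, inr e | inr e, inl i => i \in val e
  | _, _ => false
  end.

Lemma sub_adj_sym : symmetric sub_adj.
Proof. by move=> [i|e] [j|f]. Qed.

Lemma sub_adj_irr : irreflexive sub_adj.
Proof. by move=> [i|e]. Qed.

Lemma card_two_set : #|{: two_set}| = 'C(n, 2).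
Proof. by rewrite card_sig -[n in 'C(n, _)]card_ord -card_draws cardsE. Qed.

Lemma sub_vertex_gt0 : 0 < #|sub_vertex|.
Proof. by rewrite card_sum card_ord addn_gt0 n_gt0. Qed.

Definition subdivision := SGraph sub_adj_sym sub_adj_irr sub_vertex_gt0.
Implicit Types (i j : 'I_n) (e : two_set).

Definition branch : {set subdivision} := [set inl i | i : 'I_n].
Definition middle : {set subdivision} := [set inr e | e : two_set].

Lemma in_branch (x : subdivision) : (x \in branch) = if x is inl _ then true else false.
Proof.
case: x => [i|e]; first by rewrite imset_f.
by apply/imsetP => -[].
Qed.

Lemma in_middle (x : subdivision) : (x \in middle) = if x is inl _ then false else true.
Proof.
case: x => [i|e]; last by rewrite imset_f.
by apply/imsetP => -[].
Qed.

Lemma middleE : middle = ~: branch.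
Proof. by apply/setP => x; rewrite in_setC in_middle in_branch; case: x. Qed.

Lemma ends_pair i j (ij : i != j) : #|[set i; j]| == 2.
Proof. by rewrite cards2 ij. Qed.

Definition link i j (ij : i != j) : two_set := exist _ [set i; j] (ends_pair ij).

Lemma deg_branch i : deg [set: subdivision] (inl i) = n.-1.
Proof.
have -> : n.-1 = #|[set~ i]| by rewrite cardsC1 card_ord.
have inj_i : {in [set~ i] &, injective (fun j => [set i; j])}.
  move=> x y; rewrite !inE => xi _ /setP/(_ x).
  by rewrite !inE eqxx orbT (negPf xi) => /esym/eqP.
have inj_inr : injective (inr : two_set -> sub_vertex) by move=> ? ? [].
rewrite /deg -(card_in_imset inj_i).
have -> : nbr [set: subdivision] (inl i) = inr @: [set e : two_set | i \in val e].
  apply/setP => -[j|e]; rewrite !inE /=.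
    by apply/esym/imsetP => -[].
  by rewrite mem_imset // inE.
rewrite (card_imset _ inj_inr) -[LHS](card_imset _ val_inj).
apply: eq_card => e; apply/imsetP/imsetP => [[[f /= fP]]|[j]]; rewrite !inE.
  move=> /= i_f ->; have [x [y [xy f_xy]]] := cards2P _ fP.
  move: i_f; rewrite f_xy !inE => /orP[]/eqP->; first by exists y; rewrite // !inE eq_sym.
  by exists x; rewrite ?inE // setUC.
rewrite eq_sym => ij ->; exists (link ij) => //.
by rewrite !inE eqxx.
Qed.

Lemma deg_middle e : deg [set: subdivision] (inr e) = 2.
Proof.
rewrite /deg; have inj_inl : injective (inl : 'I_n -> sub_vertex) by move=> ? ? [].
rewrite -[RHS](eqP (valP e)) -(card_imset _ inj_inl).
apply: eq_card => -[j|f]; rewrite !inE /=; first by rewrite mem_imset.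
by apply/esym/imsetP => -[].
Qed.

Lemma card_branch : #|branch| = n.
Proof. by rewrite card_imset ?card_ord // => ? ? []. Qed.

Lemma card_middle : #|middle| = 'C(n, 2).
Proof. by rewrite card_imset ?card_two_set // => ? ? []. Qed.

Lemma card_subdivision : #|subdivision| = n + 'C(n, 2).
Proof. by rewrite -(cardsC branch) -middleE card_branch card_middle. Qed.

Lemma mul2_bin2 : 2 * 'C(n, 2) = n * n.-1.
Proof. by rewrite -mul_bin_diag bin1. Qed.

(** A subgraph with [a] branch vertices, [b] middle vertices and [e] edges has
    [e <= a (n - 1)] and [e <= 2 b], as each edge has one end of each kind.
    Adding the two bounds gives [e (n + 1) <= 2 (n - 1) (a + b)], and the whole
    graph attains equality. *)
Lemma mad_subdivision (R : realFieldType) :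
  mad R subdivision = (4 * (n%:R - 1) / (n%:R + 1))%R.
Proof.
have n1 : (1 <= n%:R :> R)%R by rewrite ler1n.
have n1_gt0 : (0 < n%:R + 1 :> R)%R by lra.
apply/le_anti/andP; split.
  apply: bigmax_le => [|[V E] /= /andP[V0 sVE]].
    by apply: divr_ge0; [apply: mulr_ge0|]; lra.
  have V_gt0 : (0 < #|V|%:R :> R)%R by rewrite ltr0n card_gt0.
  have le_branch : #|E| <= #|V :&: branch| * n.-1.
    apply: leq_trans (card_edges_le_cover (S := branch) sVE _) _.
      by move=> [i|e] [j|f]; rewrite !in_branch.
    rewrite -sum_nat_const leq_sum //= => -[i|e]; rewrite inE in_branch ?andbF //.
    by rewrite deg_branch.
  have le_middle : #|E| <= #|V :&: middle| * 2.
    apply: leq_trans (card_edges_le_cover (S := middle) sVE _) _.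
      by move=> [i|e] [j|f]; rewrite !in_middle.
    rewrite -sum_nat_const leq_sum //= => -[i|e]; rewrite inE in_middle ?andbF //.
    by rewrite deg_middle.
  have cardV : #|V| = #|V :&: branch| + #|V :&: middle|.
    by rewrite -(cardsID branch V) middleE setDE.
  rewrite ler_pdivrMr // mulrAC ler_pdivlMr //.
  have : 2 * #|E| * n.+1 <= 4 * n.-1 * #|V| by move: n_gt0; nia.
  rewrite -(ler_nat R) !natrM -[n.+1%:R%R]natr1.
  by rewrite -subn1 natrB.
have T0 : [set: subdivision] != set0 by rewrite -card_gt0 cardsT sub_vertex_gt0.
apply: le_trans (mad_ge R (H := (_, _)) T0 (induced_subgraph _)) => /=.
rewrite cardsT card_subdivision.
have leE : n * n.-1 <= #|induced_edges [set: subdivision]|.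
  rewrite -mul2_bin2 -card_middle mulnC -sum_nat_const.
  have -> : \sum_(v in middle) 2 = \sum_(v in middle) deg [set: subdivision] v.
    by apply: eq_bigr => -[i|e]; rewrite ?deg_middle // in_middle.
  rewrite -[leqRHS]mul1n; apply: sum_deg_le (subsetT _) _ => -[i|e] [j|f] //= _.
    rewrite (_ : _ :&: _ = [set inr f]) ?cards1 //; apply/setP => -[x|x].
      by rewrite in_setI in_middle in_set1 andbF.
    by rewrite in_setI in_middle andbT !inE.
  rewrite (_ : _ :&: _ = [set inr e]) ?cards1 //; apply/setP => -[x|x].
    by rewrite in_setI in_middle in_set1 andbF.
  by rewrite in_setI in_middle andbT !inE orbF.
have leE' : (n%:R * (n%:R - 1) <= #|induced_edges [set: subdivision]|%:R :> R)%R.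
  by rewrite -[1%R]/(1%:R)%R -natrB // -natrM ler_nat subn1.
have binE : (2 * 'C(n, 2)%:R = n%:R * (n%:R - 1) :> R)%R.
  by rewrite -[1%R in RHS]/(1%:R)%R -natrB // -!natrM subn1 mul2_bin2.
have bin_ge0 : (0 <= 'C(n, 2)%:R :> R)%R by [].
rewrite ler_pdivrMr // mulrAC ler_pdivlMr natrD; last by lra.
have : (0 <= (#|induced_edges [set: subdivision]|%:R - n%:R * (n%:R - 1)) * (n%:R + 1) :> R)%R.
  by apply: mulr_ge0; lra.
have -> : (4 * (n%:R - 1) * (n%:R + 'C(n, 2)%:R)
   = 2 * (n%:R - 1) * (2 * n%:R + 2 * 'C(n, 2)%:R) :> R)%R by ring.
rewrite binE; lra.
Qed.

(** If the ends of a subdivided edge had the same color, the middle vertex would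
    see that color twice and no other color. *)
Lemma branch_colors_distinct k (f : {ffun subdivision -> 'I_k}) :
  odd_coloring f -> injective (fun i => f (inl i)).
Proof.
move=> /andP[_ /forallP fodd] i j fij; apply/eqP; apply: contraT => ij.
have /implyP/(_ _)/existsP[|c] := fodd (inr (link ij)).
  by apply/forallPn; exists (inl i); rewrite /= !inE eqxx.
rewrite (_ : [set u | _ & _] = if f (inl i) == c then [set inl i; inl j] else set0).
  by case: ifP => _; rewrite ?cards0 // cards2 (inj_eq (@inl_inj _ _)) ij.
apply/setP => -[x|x]; rewrite inE /=.
  rewrite !inE; case: eqVneq => [<-|xi] /=.
    by case: eqP => _; rewrite ?inE ?eqxx.
  case: eqVneq => [->|xj] /=; first by rewrite -fij; case: eqP => _; rewrite !inE ?eqxx ?orbT.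
  by case: eqP => _; rewrite !inE // -!/(inl x == inl _) !(inj_eq (@inl_inj _ _)) (negPf xi) (negPf xj).
by case: ifP => _; rewrite !inE.
Qed.

(** The branch vertices have odd degree [n - 1], and a middle vertex sees two
    different colors.  A third color is left for each middle vertex. *)
Lemma subdivision_odd_colorable : 2 < n -> ~~ odd n -> odd_colorable subdivision n.
Proof.
move=> n2 n_even.
have avoid e : exists c, c \notin val e.
  apply/existsP; rewrite -negb_forall; apply: contraL n2 => /forallP eT.
  rewrite -leqNgt -[leqLHS]card_ord -(eqP (valP e)).
  by apply/subset_leq_card/subsetP => c _; apply: eT.
pose f (x : subdivision) := match x with inl i => i | inr e => xchoose (avoid e) end.
apply: (@odd_on_setT _ _ f); split.
  have neq i e : i \in val e -> i != xchoose (avoid e).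
    by apply: contraTneq => ->; exact: (xchooseP (avoid e)).
  by move=> [i|e] [j|g] _ _ /=; [| move=> /neq | move=> /neq; rewrite eq_sym |].
move=> [i|e] _.
  by apply: odd_deg_satisfied; rewrite deg_branch; case: (n) n_gt0 n_even => //= ? _; rewrite negbK.
have [i [j [ij eij]]] := cards2P _ (valP e).
apply: (@unique_color_satisfied subdivision n setT f (inr e) (inl i)); first by rewrite !inE /= eij !inE eqxx.
by move=> [x|x]; rewrite !inE //= eij => _.
Qed.

Lemma chi_o_subdivision : 2 < n -> ~~ odd n -> chi_o subdivision = n.
Proof.
move=> n2 n_even; rewrite /chi_o; case: ex_minnP => k /existsP[f fodd] k_min.
apply/eqP; rewrite eqn_leq k_min ?subdivision_odd_colorable //=.
by have := leq_card _ (branch_colors_distinct fodd); rewrite !card_ord.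
Qed.
End SubdividedComplete.

(** * The two bounds *)

Local Open Scope classical_set_scope.
Local Open Scope ring_scope.

Lemma chi_o_le_mad (R : realType) (eps : R) (G : sgraph) :
  0 < eps -> eps <= 8 / 5 -> mad R G <= 4 - eps ->
  (chi_o G)%:Z <= Num.floor (8 / eps) + 2.
Proof.
move=> e0 e1 Gmad.
have fl5 : 5%:Z <= Num.floor (8 / eps) by rewrite floor_ge_int /= ler_pdivlMr //; lra.
have [k kE] : exists k : nat, Num.floor (8 / eps) + 2 = k%:Z.
  by exists (absz (Num.floor (8 / eps) + 2)); lia.
have k6 : (6 < k)%N by lia.
(* [8 / eps] is less than its integer part plus 1, which is [k - 1]. *)
have ke : 8 < (k%:R - 1) * eps.
  rewrite -ltr_pdivrMr //; have := floorD1_gt (8 / eps).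
  rewrite (_ : Num.floor (8 / eps) + 1 = k%:Z - 1); last by lia.
  by rewrite intrB.
rewrite kE lez_nat /chi_o; case: ex_minnP => m _; apply.
have k4 : (4 < k)%N by apply: leq_trans k6.
have [f] := odd_on_by_reduction k4
  (fun A A0 => exists_reducible e0 e1 k6 ke Gmad A0) [set: G]%SET.
exact: odd_on_setT.
Qed.

Theorem theorem1 (R : realType) :
  (forall (eps : R) (G : sgraph),
      0 < eps -> eps <= 8 / 5 ->
      mad R G <= 4 - eps ->
      (chi_o G)%:Z <= Num.floor (8 / eps) + 2)
  /\
  (exists eps : nat -> R,
      [/\ injective eps,
          (forall n, 0 < eps n /\ eps n <= 8 / 5),
          eps n @[n --> \oo] --> (0 : R)
        & forall n, exists G : sgraph,
            mad R G = 4 - eps n /\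
            (chi_o G)%:Z = Num.floor (8 / eps n) - 1]).
Proof.
split; first exact: chi_o_le_mad.
(* For the even number [n = 2 m + 4], [N m] is [n + 1]. *)
pose N m : R := (2 * m + 5)%:R.
have N5 m : 5 <= N m by rewrite ler_nat; lia.
have N0 m : 0 < N m by apply: lt_le_trans (N5 m).
have NN m : N m != 0 by apply: lt0r_neq0.
have N_inv m : 8 / (8 / N m) = N m by rewrite invf_div mulrC divfK // pnatr_eq0.
exists (fun m => 8 / N m); split.
- move=> m p /(congr1 (fun x => 8 / x)); rewrite !N_inv => /eqP.
  by rewrite eqr_nat => /eqP; lia.
- by move=> m; rewrite divr_gt0 // ler_pdivrMr //; have := N5 m; split=> //; lra.
(* [8 / (2 m + 5)] is at most [4 / (m + 1)]. *)
- apply: (@squeeze_cvgr _ _ _ _ (fun=> 0) (fun m => 4 * harmonic m)).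
  + near=> m; rewrite ltW ?divr_gt0 //= ler_pdivrMr //.
    rewrite /harmonic mulrAC ler_pdivlMr ?ltr0n //.
    by rewrite /N natrD natrM -natr1; have : 0 <= m%:R :> R by []; lra.
  + exact: cvg_cst.
  + by rewrite -[X in _ --> X](mulr0 4); apply: cvgMr; apply: cvg_harmonic.
move=> m; have n0 : (0 < 2 * m + 4)%N by lia.
exists (subdivision n0); split.
  rewrite mad_subdivision.
  have -> : (2 * m + 4)%:R = N m - 1 by rewrite /N !natrD; lra.
  by have := NN m; have := N0 m => ? ?; field; lra.
rewrite N_inv chi_o_subdivision; try lia.
rewrite /N -[_%:R]/(_%:Z%:~R) intrKfloor; lia.
Unshelve. all: by end_near.
Qed.
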